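(* Let $1\le r\le q<+\infty$ and let $Y$ be a Banach space of cotype $q$. For every integer $m\geq 2$ and every integer $k$ with $1\le k<m$, \[ C_{Y,m}\le\left(C_q(Y)\,K_{\frac{qrk}{q+(k-1)r},\,2}\right)^{m-k}C_{Y,k} . \]
   Context: Scalars are $\mathbb K=\mathbb R$ or $\mathbb C$; $r_k$ denotes the $k$-th Rademacher function on $[0,1]$ and $(e_i)$ the canonical unit vectors of $c_0$. Cotype: $Y$ has cotype $q$ if there is $\kappa>0$ with $\left(\sum_{k=1}^n\|y_k\|^q\right)^{1/q}\le\kappa\left(\int_0^1\|\sum_{k=1}^n r_k(t)y_k\|^2dt\right)^{1/2}$ for all finite families in $Y$; the smallest such $\kappa$ is $C_q(Y)$. Kahane constants: for $0<a,b<+\infty$, $K_{a,b}$ is the (best) constant such that $\left(\int_0^1\|\sum_{k=1}^n r_k(t)x_k\|^b dt\right)^{1/b}\le K_{a,b}\left(\int_0^1\|\sum_{k=1}^n r_k(t)x_k\|^a dt\right)^{1/a}$ for every Banach space and all finite families $x_1,\dots,x_n$ in it. Summing operators: a bounded linear $v:X\to Y$ is $(r,1)$-summing if there is $C>0$ with $\left(\sum_{k=1}^n\|vx_k\|^r\right)^{1/r}\le C\sup_{x^*\in B_{X^*}}\sum_{k=1}^n|x^*(x_k)|$ for all finite families in $X$; the smallest $C$ is $\pi_{r,1}(v)$. Vector-valued Bohnenblust–Hille constants: for fixed $r,q,Y$ and $m\ge1$, $C_{Y,m}$ denotes the best (smallest) constant such that, for every Banach space $X$, every $(r,1)$-summing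 operator $v:X\to Y$ and every bounded $m$-linear operator $T:c_0\times\dots\times c_0\to X$, \[ \left(\sum_{i_1,\dots,i_m=1}^{+\infty}\|vT(e_{i_1},\dots,e_{i_m})\|_Y^{\frac{qrm}{q+(m-1)r}}\right)^{\frac{q+(m-1)r}{qrm}}\le C_{Y,m}\,\pi_{r,1}(v)\,\|T\| . \] It is known that this constant is finite, with $C_{Y,m}\le(\sqrt2\,C_q(Y))^{m-1}$. *)

(* Defs.v *)
From HB Require Import structures.
From mathcomp Require Import all_boot all_order all_algebra.
From mathcomp Require Import all_classical all_reals all_analysis.
From mathcomp Require Import complex.

Set Implicit Arguments.
Unset Strict Implicit.
Unset Printing Implicit Defensive.

Import Order.TTheory GRing.Theory Num.Theory.
Import numFieldNormedType.Exports.

Local Open Scope classical_set_scope.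
Local Open Scope ring_scope.

Variant scalars := RealScalars | ComplexScalars.

Definition field_of (R : realType) (s : scalars) : numFieldType :=
  match s with
  | RealScalars => R
  | ComplexScalars => R[i]
  end.

(* In a normedModType K the norm takes its values in K (as nonnegative        *)
(* elements); [nrm] is the same norm as an element of R.                      *)
Definition real_part (R : realType) (s : scalars) : field_of R s -> R :=
  match s return field_of R s -> R with
  | RealScalars => id
  | ComplexScalars => @complex.Re R
  end.

Definition nrm (R : realType) (s : scalars)
  (V : normedModType (field_of R s)) (x : V) : R := real_part `|x|.

(* Extended-real valued: +oo when no constant works. Defined as an infimum    *)
(* because the set of admissible C > 0 has no least element when C = 0 works. *)
Definition best_constant (R : realType) (P : R -> Prop) : \bar R :=
  ereal_inf [set C%:E | C in [set C : R | 0 < C /\ P C]].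

(* r_k for k >= 1, with values in the scalar field; it agrees with            *)
(* sgn (sin (2 ^ k * pi * t)) outside the dyadic points.                      *)
Definition rademacher (R : realType) (K : numFieldType) (k : nat) (t : R) : K :=
  (-1) ^+ Num.truncn (2 ^+ k * t).

Definition rademacher_average (R : realType) (s : scalars)
    (V : normedModType (field_of R s)) (p : R) (n : nat) (x : 'I_n -> V)
    : \bar R :=
  ((\int[lebesgue_measure]_(t in `[0%R, 1%R])
     ((nrm (\sum_(k < n) rademacher (field_of R s) k.+1 t *: x k)) `^ p)%:E)
     `^ p^-1)%E.

Definition cotype_ineq (R : realType) (s : scalars)
    (Y : normedModType (field_of R s)) (q kappa : R) : Prop :=
  forall (n : nat) (y : 'I_n -> Y),
    (((\sum_(k < n) nrm (y k) `^ q) `^ q^-1)%:E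
       <= kappa%:E * rademacher_average 2 y)%E.

Definition has_cotype (R : realType) (s : scalars)
    (Y : normedModType (field_of R s)) (q : R) : Prop :=
  exists kappa : R, 0 < kappa /\ cotype_ineq Y q kappa.

Definition cotype_constant (R : realType) (s : scalars)
    (Y : normedModType (field_of R s)) (q : R) : \bar R :=
  best_constant (cotype_ineq Y q).

Definition kahane_constant (R : realType) (s : scalars) (a b : R) : \bar R :=
  best_constant (fun K : R =>
    forall (X : completeNormedModType (field_of R s)) (n : nat) (x : 'I_n -> X),
      (rademacher_average b x <= K%:E * rademacher_average a x)%E).

Definition bounded_linear (R : realType) (s : scalars)
    (X Y : normedModType (field_of R s)) (v : X -> Y) : Prop :=
  linear v /\ exists M : R, forall x, nrm (v x) <= M * nrm x.

Definition dual_ball (R : realType) (s : scalars)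
    (X : normedModType (field_of R s)) : set (X -> field_of R s) :=
  [set f | scalar f /\
    forall x, nrm (f x : (field_of R s)^o) <= nrm x].

Definition summing_ineq (R : realType) (s : scalars)
    (X Y : normedModType (field_of R s)) (r : R) (v : X -> Y) (C : R) : Prop :=
  forall (n : nat) (x : 'I_n -> X),
    (((\sum_(k < n) nrm (v (x k)) `^ r) `^ r^-1)%:E
       <= C%:E * ereal_sup [set (\sum_(k < n)
            nrm (f (x k) : (field_of R s)^o))%:E | f in dual_ball (X := X)])%E.

Definition summing (R : realType) (s : scalars)
    (X Y : normedModType (field_of R s)) (r : R) (v : X -> Y) : Prop :=
  bounded_linear v /\ exists C : R, 0 < C /\ summing_ineq r v C.

Definition summing_norm (R : realType) (s : scalars)
    (X Y : normedModType (field_of R s)) (r : R) (v : X -> Y) : \bar R :=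
  best_constant (summing_ineq r v).

Definition null_seq (K : numFieldType) : {pred nat -> K} :=
  fun u => `[< u @ \oo --> (0 : K) >].

Lemma null_seq_submod_closed (K : numFieldType) :
  GRing.submod_closed (@null_seq K).
Proof.
split; first by apply/asboolP; exact: (@cvg_cst K).
move=> a u w /asboolP u0 /asboolP w0; apply/asboolP.
by rewrite -(addr0 (0 : K)) -{1}(mulr0 a); apply: cvgD => //; apply: cvgMr.
Qed.

HB.instance Definition _ (K : numFieldType) :=
  GRing.isSubmodClosed.Build K (nat -> K) (@null_seq K)
    (null_seq_submod_closed K).

Record c0 (K : numFieldType) := C0Seq {
  c0_seq :> nat -> K;
  _ : c0_seq \in @null_seq K }.

HB.instance Definition _ (K : numFieldType) := [isSub for @c0_seq K].
HB.instance Definition _ (K : numFieldType) := [Choice of c0 K by <:].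
HB.instance Definition _ (K : numFieldType) :=
  [SubChoice_isSubLmodule of c0 K by <:].

Lemma unit_vector_null (K : numFieldType) (i : nat) :
  (fun n => (n == i)%:R : K) \in @null_seq K.
Proof.
apply/asboolP; apply: cvg_near_cst; exists i.+1 => // n /= ltin.
by rewrite gtn_eqF.
Qed.

Definition unit_vector (K : numFieldType) (i : nat) : c0 K :=
  C0Seq (unit_vector_null K i).

Definition c0_norm (R : realType) (s : scalars) (u : c0 (field_of R s)) : R :=
  sup (range (fun n => nrm (u n : (field_of R s)^o))).

Definition multilinear (K : numFieldType) (m : nat) (X : lmodType K)
    (T : ('I_m -> c0 K) -> X) : Prop :=
  forall (x : 'I_m -> c0 K) (i : 'I_m),
    linear (fun u : c0 K => T (@dfwith _ (fun=> c0 K) x i u)).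

Definition bounded_multilinear (R : realType) (s : scalars) (m : nat)
    (X : normedModType (field_of R s))
    (T : ('I_m -> c0 (field_of R s)) -> X) : Prop :=
  multilinear T /\
  exists M : R, forall x, nrm (T x) <= M * \prod_(i < m) c0_norm (x i).

Definition multilinear_norm (R : realType) (s : scalars) (m : nat)
    (X : normedModType (field_of R s))
    (T : ('I_m -> c0 (field_of R s)) -> X) : \bar R :=
  ereal_sup [set (nrm (T x))%:E | x in [set x | forall i, c0_norm (x i) <= 1]].

Definition bh_constant (R : realType) (s : scalars)
    (Y : normedModType (field_of R s)) (r q : R) (m : nat) : \bar R :=
  let p := q * r * m%:R / (q + (m%:R - 1) * r) in
  best_constant (fun C : R =>
    forall (X : completeNormedModType (field_of R s)) (v : X -> Y)
      (T : ('I_m -> c0 (field_of R s)) -> X),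
      summing r v -> bounded_multilinear T ->
      ((\esum_(i in [set: {ffun 'I_m -> nat}])
          ((nrm (v (T (fun j => unit_vector (field_of R s) (i j))))) `^ p)%:E)
         `^ p^-1
       <= C%:E * summing_norm r v * multilinear_norm T)%E).

(* Main.v *)
Require Import Defs.
From HB Require Import structures.
From mathcomp Require Import all_boot all_order all_algebra.
From mathcomp Require Import all_classical all_reals all_analysis.
From mathcomp Require Import measurable_realfun zify ring lra complex.
Import Order.TTheory GRing.Theory Num.Theory.
Import numFieldNormedType.Exports.
Local Open Scope ring_scope.

(* Write p_m = qrm / (q + (m - 1) r). Since p_m increases with m and L^p means *)
(* over a probability space increase with p, it suffices to pass from m to     *)
(* m + 1 with the constant C_q(Y) K_{p_m, 2} and to iterate. For an            *)
(* (m + 1)-linear T and a slot j, cotype q and the Kahane inequality bound the *)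
(* l_q norm in i_j of v T(e_i) by the average over signs of                    *)
(* || v T(.., sum_x r_x(t) e_x, ..) ||^{p_m}; for each choice of signs this is *)
(* an m-linear map of norm at most ||T||, so summing over the other indices    *)
(* bounds the mixed l_{p_m}(l_q) norm of the coefficients. Blei's inequality   *)
(* interpolates these m + 1 mixed norms and gives the l_{p_{m+1}} norm.        *)
(* As the constants are infima in the extended reals, products 0 * +oo have to *)
(* be excluded: C_q(Y) and K are at least 1 unless Y = 0, and if C_{Y,k}       *)
(* vanishes then all the coefficients do, so C_{Y,m} vanishes as well.         *)

(** The inductive step is [bh_boundS]. For each slot, [bh_slice_le] bounds one mixed norm of the
    coefficients, and [blei_sum_le] merges these bounds. The exponents fit because 1/p_{m+1} is the
    mean of m copies of 1/p_m and one of 1/q ([bh_exponentS]). Rademacher integrals are means over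
    finitely many signs ([rademacher_averageE]), so all estimates concern finite sums until
    [esum_ffun_le] passes to infinite ones. [bh_bound_iter] iterates the step, keeping the Kahane
    constant of the starting level. The infima need not be attained, so the theorem is reached with
    admissible constants slightly above them and [le_of_approx]. *)

Lemma ler_powR2r (R : realType) (e x y : R) :
  0 <= e -> 0 <= x -> x <= y -> x `^ e <= y `^ e.
Proof.
move=> e0 x0 xy; apply: ge0_ler_powR; rewrite ?nnegrE//.
exact: le_trans xy.
Qed.

Lemma powRK (R : realType) (x a b : R) : 0 <= x -> a * b = 1 ->
  (x `^ a) `^ b = x.
Proof. by move=> x0 ab; rewrite -powRrM ab powRr1. Qed.

Lemma young_powR (R : realType) (u v w : R) : 0 <= u -> 0 <= v -> 0 < w < 1 ->
  u `^ w * v `^ (1 - w) <= w * u + (1 - w) * v.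
Proof.
move=> u0 v0 /andP[w0 w1]; have w1' : 0 < 1 - w by rewrite subr_gt0.
have w'0 : 0 < w^-1 by rewrite invr_gt0.
have w1'0 : 0 < (1 - w)^-1 by rewrite invr_gt0.
have e : w^-1^-1 + (1 - w)^-1^-1 = 1 by rewrite !invrK subrKC.
have := conjugate_powR (powR_ge0 u w) (powR_ge0 v (1 - w)) w'0 w1'0 e.
by rewrite !powRK ?mulfV ?gt_eqF// !invrK [u * _]mulrC [v * _]mulrC.
Qed.

Lemma sum_powR_le (R : realType) (I : finType) (f g : I -> R) (w : R) :
  (forall i, 0 <= f i) -> (forall i, 0 <= g i) -> 0 <= w <= 1 ->
  \sum_i f i `^ w * g i `^ (1 - w)
    <= (\sum_i f i) `^ w * (\sum_i g i) `^ (1 - w).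
Proof.
move=> f0 g0 /andP[]; rewrite le_eqVlt => /predU1P[<- _|w0].
  rewrite subr0 powRr0 mul1r powRr1 ?sumr_ge0//.
  by apply: ler_sum => i _; rewrite powRr0 mul1r powRr1.
rewrite le_eqVlt => /predU1P[->|w1].
  rewrite subrr powRr0 mulr1 powRr1 ?sumr_ge0//.
  by apply: ler_sum => i _; rewrite powRr0 mulr1 powRr1.
have w1' : 0 < 1 - w by rewrite subr_gt0.
have zero (h : I -> R) i : (forall i, 0 <= h i) -> \sum_i h i = 0 -> h i = 0.
  move=> h0 /eqP; rewrite psumr_eq0// => /allP/(_ i).
  by rewrite mem_index_enum => /(_ isT)/eqP.
set F := \sum_i f i; set G := \sum_i g i.
have [F0|F0] := eqVneq F 0.
  rewrite big1 ?mulr_ge0 ?powR_ge0// => i _.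
  by rewrite (zero f)// powR0 ?mul0r ?gt_eqF.
have [G0|G0] := eqVneq G 0.
  rewrite big1 ?mulr_ge0 ?powR_ge0// => i _.
  by rewrite (zero g)// (powR0 (lt0r_neq0 w1')) mulr0.
have Fp : 0 < F by rewrite lt_neqAle eq_sym F0 sumr_ge0.
have Gp : 0 < G by rewrite lt_neqAle eq_sym G0 sumr_ge0.
have E : \sum_i (w * (f i / F) + (1 - w) * (g i / G)) = 1.
  rewrite big_split/= -!mulr_sumr -!mulr_suml -/F -/G !mulfV//; ring.
rewrite -[leRHS]mulr1 -[X in _ <= _ * X]E mulr_sumr.
apply: ler_sum => i _.
have fF : f i = F * (f i / F) by rewrite mulrC divfK.
have gG : g i = G * (g i / G) by rewrite mulrC divfK.
have fF0 : 0 <= f i / F by rewrite divr_ge0// ltW.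
have gG0 : 0 <= g i / G by rewrite divr_ge0// ltW.
rewrite [in leLHS]fF [in leLHS]gG (powRM _ (ltW Fp))// (powRM _ (ltW Gp))//.
rewrite mulrACA ler_wpM2l ?mulr_ge0 ?powR_ge0//.
by apply: young_powR => //; rewrite w0.
Qed.

Lemma minkowski_sum (R : realType) (I J : finType) (h : I -> J -> R) (t : R) :
  (forall i j, 0 <= h i j) -> 1 <= t ->
  (\sum_i (\sum_j h i j) `^ t) `^ t^-1
    <= \sum_j (\sum_i h i j `^ t) `^ t^-1.
Proof.
move=> h0 t1; have t0 : 0 < t by exact: lt_le_trans t1.
set S := fun i => \sum_j h i j.
have S0 i : 0 <= S i by exact: sumr_ge0.
rewrite -/(S _); set Z := \sum_i _; set W := \sum_j _.
have Z0 : 0 <= Z by apply: sumr_ge0 => i _; exact: powR_ge0.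
have W0 : 0 <= W by apply: sumr_ge0 => i _; exact: powR_ge0.
have u01 : 0 <= t^-1 <= 1 by rewrite invr_ge0 ltW//= invf_le1.
have ZW : Z <= W * Z `^ (1 - t^-1).
  have ZE : Z = \sum_j \sum_i h i j * S i `^ (t - 1).
    rewrite exchange_big; apply: eq_bigr => i _ /=.
    by rewrite -mulr_suml -/(S i) mulr_powRB1.
  rewrite [leLHS]ZE /W mulr_suml; apply: ler_sum => j _.
  have := @sum_powR_le R I (fun i => h i j `^ t) (fun i => S i `^ t) t^-1
    (fun=> powR_ge0 _ _) (fun=> powR_ge0 _ _) u01.
  move=> H; apply: (le_trans _ H); apply: ler_sum => i _.
  by rewrite powRK ?mulfV ?gt_eqF// -powRrM mulrBr mulr1 mulfV ?gt_eqF.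
have [->|Zn] := eqVneq Z 0; first by rewrite powR0// invr_eq0 gt_eqF.
have Zp : 0 < Z by rewrite lt_neqAle eq_sym Zn.
rewrite -(ler_pM2r (powR_gt0 (1 - t^-1) Zp)) -powRD ?Zn ?implybT//.
by rewrite subrKC powRr1.
Qed.

(** Hölder against the constant function 1, with weight [p / p']. *)
Lemma power_mean_le (R : realType) (I : finType) (a : I -> R) (p p' : R) :
  (forall i, 0 <= a i) -> 0 < p -> p <= p' -> (0 < #|I|)%N ->
  (#|I|%:R^-1 * \sum_i a i `^ p) `^ p^-1
    <= (#|I|%:R^-1 * \sum_i a i `^ p') `^ p'^-1.
Proof.
move=> a0 p0 pp' I0; have p'0 : 0 < p' by exact: lt_le_trans pp'.
have N0 : 0 < #|I|%:R :> R by rewrite ltr0n.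
set N : R := #|I|%:R; set w := p / p'.
have w01 : 0 <= w <= 1.
  by rewrite divr_ge0 ?(ltW p0) ?(ltW p'0)//= ler_pdivrMr ?mul1r.
have := @sum_powR_le R I (fun i => a i `^ p') (fun=> 1) w
  (fun=> powR_ge0 _ _) (fun=> ler01) w01.
under eq_bigr do rewrite powR1 mulr1 -powRrM mulrC divfK ?gt_eqF//.
rewrite sumr_const -/N => H.
have -> : p'^-1 = w * p^-1 by rewrite mulrAC mulfV ?mul1r ?gt_eqF.
rewrite powRrM; apply: ler_powR2r; first by rewrite invr_ge0 ltW.
  rewrite mulr_ge0 ?invr_ge0 ?(ltW N0)// sumr_ge0// => i _; exact: powR_ge0.
rewrite powRM ?invr_ge0 ?(ltW N0)//; last first.
  by apply: sumr_ge0 => i _; exact: powR_ge0.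
rewrite -(ler_pM2l N0) mulrA mulfV ?gt_eqF// mul1r (le_trans H)//.
rewrite mulrC mulrA ler_wpM2r ?powR_ge0// -(powR_inv1 (ltW N0)) -powRrM mulN1r.
by rewrite -[X in X * _](powRr1 (ltW N0)) -powRD// (lt0r_neq0 N0) implybT.
Qed.

(** * Inserting a coordinate, and Blei's inequality *)

Definition insert {T : Type} {n : nat} (j : 'I_n.+1) (x : T) (s : 'I_n -> T)
  : 'I_n.+1 -> T := fun i => if unlift j i is Some l then s l else x.

(** Multi-indices are finite functions, so that sums can range over them; [insert] itself serves for
    the arguments of multilinear maps. *)
Definition finsert {T : Type} {n : nat} (j : 'I_n.+1) (x : T)
  (s : {ffun 'I_n -> T}) : {ffun 'I_n.+1 -> T} := [ffun i => insert j x s i].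

Lemma insert_id (T : Type) (n : nat) (j : 'I_n.+1) (x : T) (s : 'I_n -> T) :
  insert j x s j = x.
Proof. by rewrite /insert unlift_none. Qed.

Lemma insert_lift (T : Type) (n : nat) (j : 'I_n.+1) (x : T) (s : 'I_n -> T)
  (l : 'I_n) : insert j x s (lift j l) = s l.
Proof. by rewrite /insert liftK. Qed.

Lemma finsert_ord0C (T : Type) (n : nat) (j : 'I_n.+1) (x y : T)
  (s : {ffun 'I_n -> T}) :
  finsert (lift ord0 j) y (finsert ord0 x s) =
  finsert ord0 x (finsert j y s).
Proof.
apply/ffunP => i; rewrite !ffunE.
case: (unliftP ord0 i) => [i' ->|->]; last first.
  rewrite insert_id -[ord0 in LHS](_ : lift (lift ord0 j) ord0 = ord0).
    by rewrite insert_lift ffunE insert_id.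
  exact: val_inj.
rewrite insert_lift ffunE; case: (unliftP j i') => [l ->|->]; last first.
  by rewrite !insert_id.
rewrite insert_lift.
have -> : lift ord0 (lift j l) = lift (lift ord0 j) (lift ord0 l).
  by apply: val_inj; rewrite /= /bump/=; lia.
by rewrite insert_lift ffunE insert_lift.
Qed.

Lemma sum_finsert (R : realType) (I : finType) (n : nat) (j : 'I_n.+1)
    (F : {ffun 'I_n.+1 -> I} -> R) :
  \sum_i F i = \sum_x \sum_s F (finsert j x s).
Proof.
rewrite pair_big/=.
pose h (p : I * {ffun 'I_n -> I}) := finsert j p.1 p.2.
rewrite (reindex h)//; exists (fun f : {ffun 'I_n.+1 -> I} =>
    (f j, [ffun l : 'I_n => f (lift j l)] : {ffun 'I_n -> I})).
  move=> [x s] _; rewrite /h /= ffunE insert_id; congr pair.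
  by apply/ffunP => l; rewrite !ffunE insert_lift.
move=> f _; apply/ffunP => i; rewrite !ffunE.
case: (unliftP j i) => [l ->|->]; last by rewrite insert_id.
by rewrite insert_lift ffunE.
Qed.

(* Induction on the number of coordinates: writing b(x, .) for the slice of b  *)
(* at a first coordinate x, Holder interpolates between the norm               *)
(* l_1(l_{1/sigma}), controlled by the induction hypothesis, and l_t(l_1),     *)
(* which Minkowski's inequality bounds by the j = 0 term.                      *)
Lemma blei_sum_le (R : realType) (I : finType) (t : R) (n : nat)
    (b : {ffun 'I_n.+1 -> I} -> R) :
  1 <= t -> (forall i, 0 <= b i) ->
  (\sum_i b i `^ ((n%:R + t^-1) / n.+1%:R)^-1) `^ ((n%:R + t^-1) / n.+1%:R)
    <= n.+1%:R^-1 *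
    \sum_(j < n.+1) \sum_s (\sum_x b (finsert j x s) `^ t) `^ t^-1.
Proof.
move=> t1; have t0 : 0 < t by exact: lt_le_trans t1.
have u0 : 0 < t^-1 by rewrite invr_gt0.
elim: n b => [|n IH] b b0.
  rewrite add0r divr1 invrK invr1 mul1r big_ord1.
  rewrite (sum_finsert _ _ _ ord0) exchange_big/=.
  have s0 : {ffun 'I_0 -> I} by by apply: finfun => -[].
  have s0P (s : {ffun 'I_0 -> I}) : true = (s == s0).
    by apply/esym/eqP/ffunP => -[].
  by rewrite !(big_pred1 s0).
set sigma := _ / _; set sg := (n%:R + t^-1) / n.+1%:R : R.
have n1 : 0 < n.+1%:R :> R by rewrite ltr0n.
have n2 : 0 < n.+2%:R :> R by rewrite ltr0n.
have n0 : 0 <= n%:R :> R by rewrite ler0n.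
have sg0 : 0 < sg by rewrite divr_gt0// ltr_wpDl.
have sigma0 : 0 < sigma by rewrite divr_gt0// addr_gt0.
(* The interpolation weight of the first coordinate. [sgE] interpolates between 1/[sg] and 1 in the
   remaining coordinates, and [sgE'] between 1 and 1/[t] in the first; both give [sigma]. *)
set th : R := n.+2%:R^-1.
have th0 : 0 < th by rewrite invr_gt0.
have th1 : 0 < 1 - th by rewrite subr_gt0 invf_lt1// ltr1n.
have sgE : (1 - th) * sg + th = sigma.
  rewrite /th /sg /sigma -!natr1; field.
  by rewrite !natr1 !lt0r_neq0.
have sgE' : (1 - th) + th * t^-1 = sigma.
  rewrite /th /sigma -!natr1; field.
  by rewrite !natr1 !lt0r_neq0.
pose bx x s := b (finsert ord0 x s).
have bx0 x s : 0 <= bx x s by exact: b0.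
pose N x := \sum_s bx x s `^ sg^-1.
pose K x := \sum_s bx x s.
have N0 x : 0 <= N x by apply: sumr_ge0 => s _; exact: powR_ge0.
have K0 x : 0 <= K x by exact: sumr_ge0.
have E1 : 1 - (1 - th) / sigma = t^-1 * (th / sigma).
  rewrite -{1}(mulfV (lt0r_neq0 sigma0)) -mulrBl -{1}sgE'; ring.
have E2 : 1 - (1 - th) * sg / sigma = th / sigma.
  rewrite -{1}(mulfV (lt0r_neq0 sigma0)) -mulrBl -{1}sgE; ring.
(* Hölder is applied twice: in the remaining coordinates for fixed [x], then in [x]. *)
have H1 : \sum_i b i `^ sigma^-1 <=
    (\sum_x N x `^ sg) `^ ((1 - th) / sigma) *
    (\sum_x K x `^ t) `^ (1 - (1 - th) / sigma).
  rewrite (sum_finsert _ _ _ ord0).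
  have w01 : 0 <= (1 - th) / sigma <= 1.
    apply/andP; split; first by apply: divr_ge0; exact: ltW.
    by rewrite ler_pdivrMr// mul1r -sgE' lerDl mulr_ge0// ltW.
  have a01 : 0 <= (1 - th) * sg / sigma <= 1.
    apply/andP; split.
      by apply: divr_ge0; [apply: mulr_ge0|]; exact: ltW.
    by rewrite ler_pdivrMr// mul1r -sgE lerDl ltW.
  have H := @sum_powR_le R I (fun x => N x `^ sg) (fun x => K x `^ t) _
    (fun=> powR_ge0 _ _) (fun=> powR_ge0 _ _) w01.
  apply: (le_trans _ H); apply: ler_sum => x _.
  rewrite -!powRrM.
  have H' := @sum_powR_le R _ (fun s => bx x s `^ sg^-1) (bx x) _
    (fun=> powR_ge0 _ _) (bx0 x) a01.
  have -> : sg * ((1 - th) / sigma) = (1 - th) * sg / sigma by ring.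
  have -> : t * (1 - (1 - th) / sigma) = 1 - (1 - th) * sg / sigma.
    by rewrite E1 E2 mulrA mulfV ?mul1r ?lt0r_neq0.
  apply: (le_trans _ H'); apply: ler_sum => s _.
  have E : sg^-1 * ((1 - th) * sg / sigma) + (1 - (1 - th) * sg / sigma)
      = sigma^-1.
    rewrite E2 -mulrA mulrCA mulKf ?lt0r_neq0// -mulrDl subrK.
    by rewrite mul1r.
  rewrite -powRrM -powRD E// -/(bx x s).
  by rewrite invr_eq0 (negPf (lt0r_neq0 sigma0)).
have SN0 : 0 <= \sum_x N x `^ sg by apply: sumr_ge0 => x _; exact: powR_ge0.
have SK0 : 0 <= \sum_x K x `^ t by apply: sumr_ge0 => x _; exact: powR_ge0.
(* Young turns the geometric mean into an arithmetic one, matching the average over slots in the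
   conclusion. *)
have H2 : (\sum_i b i `^ sigma^-1) `^ sigma <=
    (1 - th) * (\sum_x N x `^ sg) + th * (\sum_x K x `^ t) `^ t^-1.
  apply: (le_trans (ler_powR2r _ _ _ _ (ltW sigma0) _ H1)).
    by apply: sumr_ge0 => i _; exact: powR_ge0.
  rewrite powRM ?powR_ge0// -!powRrM divfK ?lt0r_neq0//.
  have -> : (1 - (1 - th) / sigma) * sigma = t^-1 * th.
    by rewrite E1 -!mulrA mulVf ?mulr1 ?lt0r_neq0.
  rewrite powRrM.
  have := @young_powR R (\sum_x N x `^ sg) ((\sum_x K x `^ t) `^ t^-1) (1 - th).
  rewrite opprB subrKC; apply => //; first exact: powR_ge0.
  by rewrite th1 ltrBlDr ltrDl.
apply: (le_trans H2); rewrite big_ord_recl mulrDr addrC lerD//.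
  rewrite ler_pM2l// [leRHS](_ : _ =
    \sum_s (\sum_x bx x s `^ t) `^ t^-1)//.
  exact: minkowski_sum.
(* The factor [n.+1] cancels the averaging factor of the induction hypothesis. *)
have -> : (1 - th) = th * n.+1%:R.
  rewrite /th -!natr1; field.
  by rewrite !natr1 !lt0r_neq0.
rewrite -mulrA ler_pM2l//.
rewrite -ler_pdivlMl//.
have -> : \sum_(i < n.+1) \sum_s (\sum_x b (finsert (lift ord0 i) x s) `^ t)
     `^ t^-1 = \sum_x \sum_(i < n.+1)
       \sum_s (\sum_y bx x (finsert i y s) `^ t) `^ t^-1.
  rewrite [RHS]exchange_big/=; apply: eq_bigr => i _.
  rewrite (sum_finsert _ _ _ ord0); apply: eq_bigr => x _.
  apply: eq_bigr => s _; congr (_ `^ _); apply: eq_bigr => y _.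
  by rewrite finsert_ord0C.
rewrite mulr_sumr; apply: ler_sum => x _.
exact: IH.
Qed.

(** * The real-valued norm *)

Lemma nrm_ge0 (R : realType) (s : scalars) (V : normedModType (field_of R s))
  (x : V) : 0 <= nrm x.
Proof.
rewrite /nrm; have := normr_ge0 x; case: s V x => V x; first by [].
by rewrite /= lecE => /andP[].
Qed.

Lemma nrmN (R : realType) (s : scalars) (V : normedModType (field_of R s))
  (x : V) : nrm (- x) = nrm x.
Proof. by rewrite /nrm normrN. Qed.

Lemma nrm0 (R : realType) (s : scalars) (V : normedModType (field_of R s)) :
  nrm (0 : V) = 0.
Proof. by rewrite /nrm normr0; case: s V. Qed.

Lemma nrm1 (R : realType) (s : scalars) :
  nrm (1 : (field_of R s)^o) = 1.
Proof. by rewrite /nrm normr1; case: s. Qed.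

Lemma nrm_signZ (R : realType) (s : scalars)
  (V : normedModType (field_of R s)) (n : nat) (x : V) :
  nrm ((-1) ^+ n *: x) = nrm x.
Proof. by rewrite -signr_odd; case: odd; rewrite ?scaleN1r ?nrmN ?scale1r. Qed.

Local Open Scope classical_set_scope.

(** * Rademacher averages as finite means over signs *)

(** The integrand is constant on each interval [j/N, (j+1)/N[, and these are added one at a time. *)
Lemma integral_truncn (R : realType) (N : nat) (H : nat -> R) : (0 < N)%N ->
  (forall j, 0 <= H j) ->
  (\int[lebesgue_measure]_(t in `[0%R, 1%R])
     (H (Num.truncn (N%:R * t)))%:E)%E = (N%:R^-1 * \sum_(j < N) H j)%:E.
Proof.
move=> N0 H0; have Np : 0 < N%:R :> R by rewrite ltr0n.
pose F (t : R) := (H (Num.truncn (N%:R * t)))%:E.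
have F0 t : (0 <= F t)%E by rewrite lee_fin.
have mono j : j%:R / N%:R <= j.+1%:R / N%:R :> R.
  by rewrite ler_pM2r ?invr_gt0// ler_nat.
have step j : measurable_fun (`[0%R, j%:R / N%:R[ : set R) F /\
    (\int[lebesgue_measure]_(t in `[0%R, (j%:R / N%:R)%R[) F t)%E
      = (N%:R^-1 * \sum_(i < j) H i)%:E.
  elim: j => [|j [mF IH]].
    rewrite mul0r big_ord0 mulr0 set_itvco0; split.
      exact: measurable_fun_set0.
    by rewrite integral_set0.
  have FE t : t \in (`[j%:R / N%:R, j.+1%:R / N%:R[ : set R) ->
      F t = (H j)%:E.
    rewrite inE /= in_itv/= ler_pdivrMr// ltr_pdivlMr// mulrC => tN.
    by rewrite /F (truncn_def tN).
  have E : (`[0%R, j.+1%:R / N%:R[ : set R) =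
      `[0%R, j%:R / N%:R[ `|` `[j%:R / N%:R, j.+1%:R / N%:R[.
    by rewrite -itv_bndbnd_setU ?bnd_simp ?divr_ge0.
  have mF' : measurable_fun (`[j%:R / N%:R, j.+1%:R / N%:R[ : set R) F.
    apply: (eq_measurable_fun (cst (H j)%:E)); last exact: measurable_cst.
    by move=> t /FE ->.
  have mFU : measurable_fun (`[0%R, j%:R / N%:R[ `|`
      `[j%:R / N%:R, j.+1%:R / N%:R[ : set R) F.
    by apply/measurable_funU.
  rewrite E; split => //.
  rewrite ge0_integral_setU//; last first.
    apply/disj_setPS => t [] /=; rewrite !in_itv/= => /andP[_ t1] /andP[t2 _].
    by have := lt_le_trans t1 t2; rewrite ltxx.
  rewrite IH (eq_integral (cst (H j)%:E))//.
  rewrite integral_cst//= lebesgue_measure_itv/= lte_fin.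
  rewrite ltr_pM2r ?invr_gt0// ltr_nat ltnSn.
  rewrite -EFinB -mulrBl -natrB// subSnn mul1r big_ord_recr/= mulrDr.
  by rewrite -EFinM -EFinD [H j * _]mulrC.
have [mF IF] := step N; rewrite mulfV ?gt_eqF// in mF IF.
(* At the right endpoint 1 the truncation equals [N], beyond the range of the sum, but a single
   point has measure zero. *)
rewrite -IF -(@setUitv1 _ _ _ _ true) ?bnd_simp// ge0_integral_setU//.
- by rewrite integral_set1 adde0.
- by apply/measurable_funU => //; split=> //; exact: measurable_fun_set1.
- by move=> t _; rewrite lee_fin.
- apply/disj_setPS => t [] /=; rewrite in_itv/= => /andP[_ t1] t2.
  by rewrite t2 ltxx in t1.
Qed.

(** For [k < n], the value of the Rademacher function of index [k.+1] on the [j]-th dyadic interval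
    of length 2^(-n): the parity of the quotient is the binary digit number [k.+1] of j/2^n. *)
Definition dyadic_sign (K : numFieldType) (n j k : nat) : K :=
  (-1) ^+ (j %/ 2 ^ (n - k.+1)).

Lemma rademacherE (R : realType) (K : numFieldType) (n k : nat) (t : R) :
  (k < n)%N -> 0 <= t ->
  rademacher K k.+1 t = dyadic_sign K n (Num.truncn ((2 ^ n)%:R * t)) k.
Proof.
move=> kn t0; rewrite /rademacher /dyadic_sign; congr (_ ^+ _).
set d := (2 ^ (n - k.+1))%N.
have d0 : (0 < d)%N by rewrite expn_gt0.
have dE : (2 ^ n)%:R = 2 ^+ k.+1 * d%:R :> R.
  by rewrite /d !natrX -exprD subnKC.
have dp : 0 < d%:R :> R by rewrite ltr0n.
set y := 2 ^+ k.+1 * t; rewrite dE mulrAC -/y.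
have y0 : 0 <= y by rewrite mulr_ge0// exprn_ge0.
apply: truncn_def; have /andP[] := truncn_itv (mulr_ge0 y0 (ltW dp)).
set j := Num.truncn _ => j1 j2; apply/andP; split.
  rewrite -(ler_pM2r dp) (le_trans _ j1)// -natrM ler_nat.
  exact: leq_trunc_div.
rewrite -(ltr_pM2r dp) (lt_le_trans j2)// -natrM ler_nat.
by rewrite ltn_ceil.
Qed.

Lemma rademacher_averageE (R : realType) (s : scalars)
    (V : normedModType (field_of R s)) (p : R) (n : nat) (x : 'I_n -> V) :
  rademacher_average p x =
  (((2 ^ n)%:R^-1 * \sum_(j < 2 ^ n)
     nrm (\sum_(k < n) dyadic_sign (field_of R s) n j k *: x k) `^ p)
       `^ p^-1)%:E.
Proof.
rewrite /rademacher_average -poweR_EFin; congr (_ `^ _)%E.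
rewrite -(@integral_truncn R (2 ^ n)
  (fun j => nrm (\sum_(k < n) dyadic_sign (field_of R s) n j k *: x k) `^ p)).
- apply: eq_integral => t; rewrite inE/= in_itv/= => /andP[t0 _].
  congr ((nrm _ `^ _)%:E); apply: eq_bigr => k _.
  by rewrite (@rademacherE _ _ n).
- by rewrite expn_gt0.
- by move=> j; exact: powR_ge0.
Qed.

Lemma rademacher_average1 (R : realType) (s : scalars)
    (V : normedModType (field_of R s)) (p : R) (y : V) : 0 < p ->
  rademacher_average p (fun _ : 'I_1 => y) = (nrm y)%:E.
Proof.
move=> p0; rewrite rademacher_averageE; congr EFin.
under eq_bigr do rewrite big_ord1 nrm_signZ.
rewrite sumr_const card_ord expn1 -[X in _ * X]mulr_natl mulrA mulVf//.
by rewrite mul1r powRK ?nrm_ge0// mulfV ?gt_eqF.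
Qed.

Lemma rademacher_average_le (R : realType) (s : scalars)
    (V : normedModType (field_of R s)) (p p' : R) (n : nat) (x : 'I_n -> V) :
  0 < p -> p <= p' -> (rademacher_average p x <= rademacher_average p' x)%E.
Proof.
move=> p0 pp'; rewrite !rademacher_averageE lee_fin.
have := @power_mean_le R 'I_(2 ^ n)
  (fun j => nrm (\sum_(k < n) dyadic_sign (field_of R s) n j k *: x k)) p p'.
by rewrite card_ord expn_gt0; apply => // i; exact: nrm_ge0.
Qed.

(** * Best constants as infima *)

Lemma best_constant_ge0 (R : realType) (P : R -> Prop) :
  (0 <= best_constant P)%E.
Proof.
by apply: le_ereal_inf_tmp => _ [C [C0 _] <-]; rewrite lee_fin ltW.
Qed.

Lemma best_constant_le (R : realType) (P : R -> Prop) (C : R) :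
  0 < C -> P C -> (best_constant P <= C%:E)%E.
Proof. by move=> C0 PC; apply: ereal_inf_lbound; exists C. Qed.

Lemma best_constant_fin (R : realType) (P : R -> Prop) (C : R) :
  0 < C -> P C -> exists2 c : R, 0 <= c & best_constant P = c%:E.
Proof.
move=> C0 PC; have := best_constant_le _ _ _ C0 PC.
have := best_constant_ge0 _ P.
by case: best_constant => // c; rewrite lee_fin => c0 _; exists c.
Qed.

Lemma best_constant_lt (R : realType) (P : R -> Prop) (d : R) :
  (best_constant P < d%:E)%E -> exists C, [/\ 0 < C, P C & C < d].
Proof.
by move=> /ereal_inf_lt[_ [C [C0 PC] <-]]; rewrite lte_fin => Cd; exists C.
Qed.

(** * Norms on [c0] and slices of multilinear maps *)

Lemma linear_sumZ (K : numFieldType) (V W : lmodType K) (f : V -> W) (n : nat)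
  (c : 'I_n -> K) (x : 'I_n -> V) :
  linear f -> f (\sum_k c k *: x k) = \sum_k c k *: f (x k).
Proof.
move=> lf; have f0 : f 0 = 0.
  by have := lf (-1) 0 0; rewrite scaler0 add0r scaleN1r addNr.
by elim/big_rec2: _ => // k y1 y2 _ <-; rewrite lf.
Qed.

Lemma c0_norm_ge0 (R : realType) (s : scalars) (u : c0 (field_of R s)) :
  0 <= c0_norm u.
Proof.
rewrite /c0_norm; set A := (X in sup X).
have A0 : A (nrm (u 0%N : (field_of R s)^o)) by exists 0%N.
have [hA|nA] := pselect (has_ubound A).
  by apply: (le_trans (nrm_ge0 _ _ _ _)); exact: (ub_le_sup hA A0).
(* Without an upper bound [sup] takes its default value 0, which is nonnegative too. *)
by rewrite sup_out// => -[].
Qed.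

Lemma c0_norm_le (R : realType) (s : scalars) (u : c0 (field_of R s)) (M : R) :
  (forall n, nrm (u n : (field_of R s)^o) <= M) -> c0_norm u <= M.
Proof.
move=> uM; apply: ge_sup; last by move=> _ [n _ <-].
by exists (nrm (u 0%N : (field_of R s)^o)); exists 0%N.
Qed.

Lemma c0_norm0 (R : realType) (s : scalars) :
  c0_norm (0 : c0 (field_of R s)) <= 1.
Proof.
by apply: c0_norm_le => n; rewrite [X in nrm X](_ : _ = 0)// nrm0.
Qed.

(** The entries of this vector are signs below [N] and 0 from [N] on. *)
Lemma c0_norm_signs (R : realType) (s : scalars) (N d : nat) :
  c0_norm (\sum_(x < N) dyadic_sign (field_of R s) N d x *:
    unit_vector (field_of R s) x) <= 1.
Proof.
apply: c0_norm_le => n.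
have lin : linear (fun u : c0 (field_of R s) => u n : (field_of R s)^o) by [].
rewrite (linear_sumZ _ _ _ _ _ _ _ lin)/=.
have [nN|Nn] := ltnP n N; last first.
  rewrite big1 ?nrm0// => x _.
  by rewrite gtn_eqF ?scaler0// (leq_trans (ltn_ord x)).
rewrite (bigD1 (Ordinal nN))//= big1 ?addr0 => [|x /eqP xn].
  by rewrite eqxx nrm_signZ nrm1.
case: eqP => [nx|_]; last by rewrite scaler0.
by case: xn; exact: val_inj.
Qed.

Lemma dfwith_insert (T : Type) (n : nat) (j : 'I_n.+1) (u w : T)
    (s : 'I_n -> T) (l : 'I_n) :
  @dfwith _ (fun=> T) (insert j u s) (lift j l) w =
  insert j u (@dfwith _ (fun=> T) s l w).
Proof.
apply/funext => i; case: (unliftP j i) => [l' ->|->]; last first.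
  by rewrite dfwithout ?insert_id// eq_sym neq_lift.
rewrite insert_lift; have [<-|ll'] := eqVneq l l'; first by rewrite !dfwithin.
by rewrite !dfwithout ?insert_lift// (inj_eq lift_inj).
Qed.

Lemma dfwith_insert_id (T : Type) (n : nat) (j : 'I_n.+1) (u w : T)
    (s : 'I_n -> T) :
  @dfwith _ (fun=> T) (insert j u s) j w = insert j w s.
Proof.
apply/funext => i; case: (unliftP j i) => [l' ->|->].
  by rewrite dfwithout ?neq_lift// !insert_lift.
by rewrite dfwithin insert_id.
Qed.

Lemma insert_linear (K : numFieldType) (m : nat) (X : lmodType K)
    (T : ('I_m.+1 -> c0 K) -> X) (j : 'I_m.+1) (s : 'I_m -> c0 K) :
  multilinear T -> linear (fun u => T (insert j u s)).
Proof.
move=> /(_ (insert j 0 s) j) H a u w; have := H a u w.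
by rewrite !dfwith_insert_id.
Qed.

Lemma insert_bounded (R : realType) (s : scalars) (m : nat)
    (X : normedModType (field_of R s))
    (T : ('I_m.+1 -> c0 (field_of R s)) -> X) (j : 'I_m.+1)
    (u : c0 (field_of R s)) :
  bounded_multilinear T -> bounded_multilinear (fun x => T (insert j u x)).
Proof.
move=> [mT [M TM]]; split.
  by move=> x i a w w'; have := mT (insert j u x) (lift j i) a w w';
     rewrite !dfwith_insert.
exists (M * c0_norm u) => x; apply: (le_trans (TM _)).
rewrite (bigD1_ord j)//= insert_id -mulrA.
by under eq_bigr do rewrite insert_lift.
Qed.

Lemma insert_norm_le (R : realType) (s : scalars) (m : nat)
    (X : normedModType (field_of R s))
    (T : ('I_m.+1 -> c0 (field_of R s)) -> X) (j : 'I_m.+1)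
    (u : c0 (field_of R s)) : c0_norm u <= 1 ->
  (multilinear_norm (fun x => T (insert j u x)) <= multilinear_norm T)%E.
Proof.
move=> u1; apply: le_ereal_sup => _ [x x1 <-]; exists (insert j u x) => // i.
case: (unliftP j i) => [l ->|->]; last by rewrite insert_id.
by rewrite insert_lift.
Qed.

Lemma multilinear_norm_fin (R : realType) (s : scalars) (m : nat)
    (X : normedModType (field_of R s))
    (T : ('I_m -> c0 (field_of R s)) -> X) : bounded_multilinear T ->
  exists2 M : R, 0 <= M & multilinear_norm T = M%:E.
Proof.
move=> [_ [M TM]].
have : (0 <= multilinear_norm T)%E.
  apply: (@le_trans _ _ (nrm (T (fun=> 0)))%:E); first by rewrite lee_fin nrm_ge0.
  by apply: ereal_sup_ubound; exists (fun=> 0) => // i; exact: c0_norm0.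
have : (multilinear_norm T <= `|M|%:E)%E.
  apply: ge_ereal_sup => _ [x x1 <-]; rewrite lee_fin (le_trans (TM x))//.
  apply: (@le_trans _ _ (`|M| * \prod_(i < m) c0_norm (x i))).
    by rewrite ler_wpM2r ?ler_norm// prodr_ge0// => i _; exact: c0_norm_ge0.
  rewrite ler_piMr// -[leRHS](@big1_eq _ _ *%R _ (index_enum 'I_m) xpredT).
  by apply: ler_prod => i _; rewrite c0_norm_ge0 x1.
by case: multilinear_norm => // M' _; rewrite lee_fin; exists M'.
Qed.

(** * From finite boxes of multi-indices to infinite sums *)

Definition ffun_nat {m N : nat} (b : {ffun 'I_m -> 'I_N}) : {ffun 'I_m -> nat} :=
  [ffun j => nat_of_ord (b j)].

Lemma ffun_nat_inj (m N : nat) : injective (@ffun_nat m N).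
Proof.
move=> b c bc; apply/ffunP => j; apply: val_inj.
by move/ffunP: bc => /(_ j); rewrite !ffunE.
Qed.

Lemma sum_ffun_natE (R : realType) (m N : nat) (a : {ffun 'I_m -> nat} -> R) :
  (\sum_(x \in range (@ffun_nat m N)) (a x)%:E)%E =
  (\sum_(b : {ffun 'I_m -> 'I_N}) a (ffun_nat b))%:E.
Proof.
rewrite -sumEFin -(big_map (@ffun_nat m N) xpredT (fun x => (a x)%:E)).
have u : uniq [seq @ffun_nat m N b | b <- index_enum {ffun 'I_m -> 'I_N}].
  by rewrite (map_inj_uniq (@ffun_nat_inj m N)) index_enum_uniq.
rewrite (fsbig_seq _ _ u).
suff -> : range (@ffun_nat m N) = [set` map (@ffun_nat m N) (index_enum _)].
  by [].
apply/seteqP; split => [_ [b _ <-]|x /= /mapP[b _ ->]]; last by exists b.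
by apply/mapP; exists b; rewrite ?mem_index_enum.
Qed.

Lemma finite_range_ffun_nat (m N : nat) : finite_set (range (@ffun_nat m N)).
Proof. by apply: finite_image; exact: finite_finset. Qed.

Lemma sum_ffun_le_esum (R : realType) (m N : nat)
    (a : {ffun 'I_m -> nat} -> R) :
  ((\sum_(b : {ffun 'I_m -> 'I_N}) a (ffun_nat b))%:E
     <= \esum_(i in [set: {ffun 'I_m -> nat}]) (a i)%:E)%E.
Proof.
apply: esum_ge; exists (range (@ffun_nat m N)); last by rewrite sum_ffun_natE.
by split => //; exact: finite_range_ffun_nat.
Qed.

(** Every finite set of multi-indices lies in a box, so box sums control the infinite sum. *)
Lemma esum_ffun_le (R : realType) (m : nat)
    (a : {ffun 'I_m -> nat} -> R) (M : R) : (forall i, 0 <= a i) ->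
  (forall N, \sum_(b : {ffun 'I_m -> 'I_N}) a (ffun_nat b) <= M) ->
  (\esum_(i in [set: {ffun 'I_m -> nat}]) (a i)%:E <= M%:E)%E.
Proof.
move=> a0 aM; apply: ge_ereal_sup => _ [A [finA _] <-].
have [N AN] : exists N, forall f, A f -> forall j, (f j < N)%N.
  have /finite_seqP[t ->] := finA; elim: t => [|f t [N IH]]; first by exists 0%N.
  exists (maxn (\max_j f j).+1 N) => g /=; rewrite inE => /predU1P[->|gt] j.
    by rewrite leq_max ltnS leq_bigmax.
  by rewrite leq_max (IH g)// orbT.
apply: (@le_trans _ _ (\sum_(x \in range (@ffun_nat m N)) (a x)%:E)%E).
  apply: lee_fsum_nneg_subset => //; first exact: finite_range_ffun_nat.
    move=> f; rewrite !inE => Af.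
    exists [ffun j => Ordinal (AN f Af j)] => //.
    by apply/ffunP => j; rewrite !ffunE.
  by move=> f _; rewrite lee_fin.
by rewrite sum_ffun_natE lee_fin.
Qed.

(** * Arithmetic of the exponents *)

Definition bh_exponent {R : realType} (r q : R) (m : nat) : R :=
  q * r * m%:R / (q + (m%:R - 1) * r).

Lemma bh_denominator_gt0 (R : realType) (r q : R) (m : nat) :
  1 <= r -> r <= q -> (0 < m)%N -> 0 < q + (m%:R - 1) * r.
Proof.
move=> h1r hrq; case: m => // m _; rewrite -natr1 addrK ltr_wpDr ?mulr_ge0//.
all: lra.
Qed.

Lemma bh_exponent_gt0 (R : realType) (r q : R) (m : nat) :
  1 <= r -> r <= q -> (0 < m)%N -> 0 < bh_exponent r q m.
Proof.
move=> h1r hrq m0; rewrite /bh_exponent divr_gt0 ?bh_denominator_gt0//.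
by rewrite !mulr_gt0 ?ltr0n//; lra.
Qed.

Lemma bh_exponent_mono (R : realType) (r q : R) (m n : nat) :
  1 <= r -> r <= q -> (0 < m)%N -> (m <= n)%N ->
  bh_exponent r q m <= bh_exponent r q n.
Proof.
move=> h1r hrq m0 mn; have n0 := leq_trans m0 mn.
rewrite /bh_exponent ler_pdivrMr ?bh_denominator_gt0//.
rewrite [leRHS]mulrAC ler_pdivlMr ?bh_denominator_gt0//.
have mn' : m%:R <= n%:R :> R by rewrite ler_nat.
rewrite -subr_ge0 [leRHS](_ : _ = q * r * ((n%:R - m%:R) * (q - r))); last ring.
by rewrite !mulr_ge0 ?subr_ge0//; lra.
Qed.

Lemma bh_exponent_le_q (R : realType) (r q : R) (m : nat) :
  1 <= r -> r <= q -> (0 < m)%N -> bh_exponent r q m <= q.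
Proof.
move=> h1r hrq m0; rewrite /bh_exponent ler_pdivrMr ?bh_denominator_gt0//.
rewrite -subr_ge0 [leRHS](_ : _ = q * (q - r)); last ring.
by rewrite mulr_ge0 ?subr_ge0//; lra.
Qed.

(** Blei's inequality with [t = q / p_m], applied to the p_m-th powers of the coefficients, yields
    exactly the exponent p_{m+1}. *)
Lemma bh_exponentS (R : realType) (r q : R) (m : nat) :
  1 <= r -> r <= q -> (0 < m)%N ->
  bh_exponent r q m *
    ((m%:R + (q / bh_exponent r q m)^-1) / m.+1%:R)^-1 =
  bh_exponent r q m.+1.
Proof.
move=> h1r hrq m0; rewrite /bh_exponent -(natr1 m) addrK.
have d1 := bh_denominator_gt0 _ _ _ _ h1r hrq m0.
have d2 := bh_denominator_gt0 _ _ _ m.+1 h1r hrq isT.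
rewrite -natr1 addrK in d2.
have m1 : 0 < m%:R :> R by rewrite ltr0n.
have r0 : 0 < r by lra.
have q0 : 0 < q by lra.
field; rewrite natr1 pnatr_eq0 !lt0r_neq0//=.
have -> : m%:R * (q + (m%:R - 1) * r) + r * m%:R = m%:R * (q + m%:R * r) by ring.
exact: mulr_gt0.
Qed.

(** * The step from [m] to [m.+1] *)

Definition unit_vectors {K : numFieldType} {m : nat} (i : {ffun 'I_m -> nat})
  : 'I_m -> c0 K := fun j => unit_vector K (i j).

Lemma unit_vectors_finsert (K : numFieldType) (m : nat) (j : 'I_m.+1) (x : nat)
  (i : {ffun 'I_m -> nat}) :
  unit_vectors (finsert j x i) = insert j (unit_vector K x) (unit_vectors i).
Proof.
apply/funext => l; rewrite /unit_vectors ffunE.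
by case: (unliftP j l) => [l' ->|->]; rewrite ?insert_id// !insert_lift.
Qed.

Lemma ffun_nat_finsert (m N : nat) (j : 'I_m.+1) (x : 'I_N)
  (i : {ffun 'I_m -> 'I_N}) :
  ffun_nat (finsert j x i) = finsert j (x : nat) (ffun_nat i).
Proof.
apply/ffunP => l; rewrite !ffunE.
by case: (unliftP j l) => [l' ->|->]; rewrite ?insert_id// !insert_lift ffunE.
Qed.

(** Convertible with the predicate whose best constant is [bh_constant]. *)
Definition bh_bound {R : realType} {s : scalars}
    (Y : normedModType (field_of R s)) (r q : R) (m : nat) (C : R) : Prop :=
  forall (X : completeNormedModType (field_of R s)) (v : X -> Y)
    (T : ('I_m -> c0 (field_of R s)) -> X),
    summing r v -> bounded_multilinear T ->
    ((\esum_(i in [set: {ffun 'I_m -> nat}])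
        ((nrm (v (T (unit_vectors i)))) `^ bh_exponent r q m)%:E)
       `^ (bh_exponent r q m)^-1
     <= C%:E * summing_norm r v * multilinear_norm T)%E.

Lemma summing_norm_fin (R : realType) (s : scalars)
    (X Y : normedModType (field_of R s)) (r : R) (v : X -> Y) : summing r v ->
  exists2 c : R, 0 <= c & summing_norm r v = c%:E.
Proof. by move=> [_ [C [C0 vC]]]; exact: best_constant_fin vC. Qed.

(** The finite form of the bound. [M] is any upper bound for the norm, so that one [M] serves all
    slices of a map. *)
Lemma bh_bound_sum_le (R : realType) (s : scalars)
    (Y : normedModType (field_of R s)) (r q : R) (m N : nat) (C : R) :
  1 <= r -> r <= q -> (0 < m)%N -> 0 < C -> bh_bound Y r q m C ->
  forall (X : completeNormedModType (field_of R s)) (v : X -> Y)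
    (T : ('I_m -> c0 (field_of R s)) -> X) (c M : R),
    summing r v -> bounded_multilinear T ->
    0 <= c -> summing_norm r v = c%:E ->
    0 <= M -> (multilinear_norm T <= M%:E)%E ->
    \sum_(i : {ffun 'I_m -> 'I_N})
      nrm (v (T (unit_vectors (ffun_nat i)))) `^ bh_exponent r q m
      <= (C * c * M) `^ bh_exponent r q m.
Proof.
move=> h1r hrq m0 C0 bhC X v T c M sv bT cge0 cE M0 TM.
set p := bh_exponent r q m.
have p0 : 0 < p by exact: bh_exponent_gt0.
set S := \sum_i _; have S0 : 0 <= S by apply: sumr_ge0 => i _; exact: powR_ge0.
have H : ((S%:E) `^ p^-1 <= (C * c * M)%:E)%E.
  apply: (@le_trans _ _ (C%:E * summing_norm r v * multilinear_norm T)%E).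
    apply: le_trans (bhC X v T sv bT).
    apply: gt0_ler_poweR; rewrite ?invr_ge0 ?(ltW p0)//.
    - by rewrite in_itv/= lee_fin S0 leey.
    - rewrite in_itv/= leey andbT; apply: esum_ge0 => i _.
      by rewrite lee_fin powR_ge0.
    exact: (@sum_ffun_le_esum R m N
      (fun i => nrm (v (T (unit_vectors i))) `^ p)).
  by rewrite cE !EFinM lee_wpmul2l// -EFinM lee_fin mulr_ge0// ltW.
rewrite poweR_EFin lee_fin in H.
rewrite -(@powRK _ S p^-1 p) ?mulVf ?gt_eqF//.
by apply: ler_powR2r => //; [exact: ltW|exact: powR_ge0].
Qed.

(* For [d < 2 ^ N], plugging the signs of the [d]-th dyadic interval into the
   [j]-th slot of [T] leaves an [m]-linear map of norm at most that of [T]. *)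
Lemma bh_slice_le (R : realType) (s : scalars)
    (Y : normedModType (field_of R s)) (r q : R) (m N : nat) (kappa K C : R) :
  1 <= r -> r <= q -> (0 < m)%N -> 0 < kappa -> 0 < K -> 0 < C ->
  cotype_ineq Y q kappa ->
  (forall n (x : 'I_n -> Y), (rademacher_average 2 x <=
    K%:E * rademacher_average (bh_exponent r q m) x)%E) ->
  bh_bound Y r q m C ->
  forall (X : completeNormedModType (field_of R s)) (v : X -> Y)
    (T : ('I_m.+1 -> c0 (field_of R s)) -> X) (c M : R) (j : 'I_m.+1),
    summing r v -> bounded_multilinear T ->
    0 <= c -> summing_norm r v = c%:E ->
    0 <= M -> multilinear_norm T = M%:E ->
    \sum_(i : {ffun 'I_m -> 'I_N}) (\sum_(x < N)
      nrm (v (T (unit_vectors (ffun_nat (finsert j x i))))) `^ q)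
        `^ (bh_exponent r q m / q)
      <= (kappa * K * C * c * M) `^ bh_exponent r q m.
Proof.
move=> h1r hrq m0 kappa0 K0 C0 cotY KY bhC X v T c M j sv bT cge0 cE M0 TM.
set p := bh_exponent r q m.
have p0 : 0 < p by exact: bh_exponent_gt0.
have lv : linear v by case: sv => -[].
pose F := field_of R s.
pose u (d : nat) : c0 F :=
  \sum_(x < N) dyadic_sign F N d x *: unit_vector F x.
pose Td d := fun w => T (insert j (u d) w).
(* For fixed [i], cotype and then Kahane, applied to the [N] coefficients obtained by varying slot
   [j]. *)
have pt (i : {ffun 'I_m -> 'I_N}) : (\sum_(x < N)
      nrm (v (T (unit_vectors (ffun_nat (finsert j x i))))) `^ q) `^ (p / q)
    <= (kappa * K) `^ p * ((2 ^ N)%:R^-1 * \sum_(d < 2 ^ N)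
      nrm (v (Td d (unit_vectors (ffun_nat i)))) `^ p).
  pose y (x : 'I_N) : Y := v (T (unit_vectors (ffun_nat (finsert j x i)))).
  have := cotY N y; have := KY N y; rewrite !rademacher_averageE -!EFinM !lee_fin.
  set A2 := (_ `^ 2^-1); set Ap := (_ * \sum_(_ < _) _); move=> H1 H2.
  have Ap0 : 0 <= Ap.
    by rewrite mulr_ge0// ?invr_ge0// sumr_ge0// => d _; exact: powR_ge0.
  have H : (\sum_x nrm (y x) `^ q) `^ q^-1 <= kappa * K * Ap `^ p^-1.
    apply: (le_trans H2); rewrite -mulrA.
    by apply: ler_wpM2l; [exact: ltW | exact: H1].
  rewrite mulrC powRrM.
  apply: (le_trans (ler_powR2r _ _ _ _ (ltW p0) (powR_ge0 _ _) H)).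
  rewrite powRM ?mulr_ge0 ?powR_ge0 ?(ltW kappa0) ?(ltW K0)//.
  rewrite powRK ?mulVf ?gt_eqF// /Ap.
  rewrite ler_wpM2l ?powR_ge0// ler_wpM2l ?invr_ge0//.
  apply: ler_sum => d _; rewrite [leLHS](_ : _ =
    nrm (v (Td d (unit_vectors (ffun_nat i)))) `^ p)//.
  congr (nrm _ `^ _); rewrite /Td /u.
  (* Linearity in slot [j] and of [v] moves the signed sum of vectors inside, as the single argument
     [u d]. *)
  rewrite (linear_sumZ _ _ _ _ _ _ _ (insert_linear _ _ _ _ _ _ bT.1)).
  rewrite (linear_sumZ _ _ _ _ _ _ _ lv); apply: eq_bigr => x _.
  by rewrite /y ffun_nat_finsert unit_vectors_finsert.
apply: (le_trans (ler_sum _ (fun i _ => pt i))).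
rewrite -!mulr_sumr exchange_big/=.
have -> : kappa * K * C * c * M = (kappa * K) * (C * c * M) by rewrite !mulrA.
rewrite [leRHS]powRM ?mulr_ge0 ?(ltW kappa0) ?(ltW K0) ?(ltW C0)//.
rewrite ler_wpM2l ?powR_ge0// ler_pdivrMl ?ltr0n ?expn_gt0//.
(* All 2^N sign choices obey the same bound, so their mean does. *)
apply: (@le_trans _ _ (\sum_(d < 2 ^ N) (C * c * M) `^ p)); last first.
  by rewrite sumr_const card_ord mulr_natl.
apply: ler_sum => d _.
apply: (bh_bound_sum_le _ _ _ _ _ _ _ _ h1r hrq m0 C0 bhC) => //.
  exact: insert_bounded.
by rewrite -TM; apply: insert_norm_le; exact: c0_norm_signs.
Qed.

Lemma bh_boundS (R : realType) (s : scalars)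
    (Y : normedModType (field_of R s)) (r q : R) (m : nat) (kappa K C : R) :
  1 <= r -> r <= q -> (0 < m)%N -> 0 < kappa -> 0 < K -> 0 < C ->
  cotype_ineq Y q kappa ->
  (forall n (x : 'I_n -> Y), (rademacher_average 2 x <=
    K%:E * rademacher_average (bh_exponent r q m) x)%E) ->
  bh_bound Y r q m C -> bh_bound Y r q m.+1 (kappa * K * C).
Proof.
move=> h1r hrq m0 kappa0 K0 C0 cotY KY bhC X v T sv bT.
have [c cge0 cE] := summing_norm_fin _ _ _ _ _ _ sv.
have [M M0 TM] := multilinear_norm_fin _ _ _ _ _ bT.
set P := bh_exponent r q m.+1; set p := bh_exponent r q m.
have p0 : 0 < p by exact: bh_exponent_gt0.
have P0 : 0 < P by exact: bh_exponent_gt0.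
have q0 : 0 < q by lra.
rewrite cE TM -!EFinM; set A := kappa * K * C * c * M.
have A0 : 0 <= A by rewrite !mulr_ge0// ltW.
rewrite -(@powRK _ A P P^-1) ?mulfV ?gt_eqF// -poweR_EFin.
apply: gt0_ler_poweR; rewrite ?invr_ge0 ?(ltW P0)//.
- rewrite in_itv/= leey andbT; apply: esum_ge0 => i _.
  by rewrite lee_fin powR_ge0.
- by rewrite in_itv/= lee_fin powR_ge0 leey.
apply: esum_ffun_le => [i|N]; first exact: powR_ge0.
pose a (i : {ffun 'I_m.+1 -> 'I_N}) : R :=
  nrm (v (T (unit_vectors (ffun_nat i)))).
have a0 i : 0 <= a i by exact: nrm_ge0.
have t1 : 1 <= q / p by rewrite ler_pdivlMr// mul1r bh_exponent_le_q.
have := @blei_sum_le R 'I_N (q / p) m (fun i => a i `^ p) t1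
  (fun=> powR_ge0 _ _).
have := bh_exponentS _ _ _ _ h1r hrq m0; rewrite -/p -/P.
set sigma := _ / m.+1%:R => PE.
have s0 : 0 < sigma^-1 by rewrite -(pmulr_rgt0 _ p0) PE.
under eq_bigr do rewrite -powRrM PE.
set S := \sum_i _ => H.
have {}H : S `^ sigma <= A `^ p.
  apply: (le_trans H); rewrite ler_pdivrMl ?ltr0n//.
  rewrite mulr_natl -[X in _ *+ X](card_ord m.+1) -sumr_const.
  apply: ler_sum => j _.
  apply: le_trans (bh_slice_le _ _ _ _ _ _ N _ _ _ h1r hrq m0 kappa0 K0 C0
    cotY KY bhC X v T c M j sv bT cge0 cE M0 TM).
  apply: ler_sum => i _; rewrite -/p.
  have -> : p / q = (q / p)^-1 by rewrite invrM ?invrK ?unitfE ?invr_eq0 ?gt_eqF.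
  under eq_bigr do rewrite -powRrM [p * _]mulrC divfK ?gt_eqF//.
  exact: lexx.
have S0 : 0 <= S by apply: sumr_ge0 => i _; exact: powR_ge0.
rewrite -[leLHS](@powRK _ S sigma sigma^-1)//; last first.
  by rewrite mulfV// -invr_eq0 gt_eqF.
by rewrite -PE powRrM; apply: ler_powR2r (ltW s0) (powR_ge0 _ _) H.
Qed.

(** * Degenerate cases: vanishing coefficients and lower bounds for the constants *)

Definition bh_vanishes {R : realType} {s : scalars}
    (Y : normedModType (field_of R s)) (r : R) (m : nat) : Prop :=
  forall (X : completeNormedModType (field_of R s)) (v : X -> Y)
    (T : ('I_m -> c0 (field_of R s)) -> X),
    summing r v -> bounded_multilinear T ->
    forall i : {ffun 'I_m -> nat}, nrm (v (T (unit_vectors i))) = 0.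

(** Freezing the first argument at a unit vector lowers the degree by one without changing the
    coefficients. *)
Lemma bh_vanishes_add (R : realType) (s : scalars)
    (Y : normedModType (field_of R s)) (r : R) (m n : nat) :
  bh_vanishes Y r m -> bh_vanishes Y r (n + m).
Proof.
move=> vm; elim: n => // n IH X v T sv bT i.
rewrite (_ : i = finsert ord0 (i ord0) [ffun l => i (lift ord0 l)]).
  rewrite unit_vectors_finsert.
  exact: (IH X v _ sv (insert_bounded _ _ _ _ _ ord0 _ bT)).
apply/ffunP => l; rewrite ffunE.
by case: (unliftP ord0 l) => [l' ->|->]; rewrite ?insert_id// insert_lift ffunE.
Qed.

Lemma bh_vanishes_constant (R : realType) (s : scalars)
    (Y : normedModType (field_of R s)) (r q : R) (m : nat) :
  1 <= r -> r <= q -> (0 < m)%N -> bh_vanishes Y r m ->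
  (bh_constant Y r q m <= 0)%E.
Proof.
move=> h1r hrq m0 vm; apply/lee_addgt0Pr => e e0; rewrite add0e.
have p0 : 0 < bh_exponent r q m by exact: bh_exponent_gt0.
apply: best_constant_le => // X v T sv bT.
have [c cge0 ->] := summing_norm_fin _ _ _ _ _ _ sv.
have [M M0 ->] := multilinear_norm_fin _ _ _ _ _ bT.
rewrite esum1 => [|i _]; last first.
  by rewrite (vm X v T sv bT i) powR0 ?gt_eqF.
rewrite poweR0r ?invr_eq0 ?gt_eqF// -!EFinM lee_fin.
by rewrite !mulr_ge0// ltW.
Qed.

(** A zero infimum gives arbitrarily small admissible constants, and each of them bounds every
    single coefficient. *)
Lemma bh_constant0_vanishes (R : realType) (s : scalars)
    (Y : normedModType (field_of R s)) (r q : R) (m : nat) :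
  1 <= r -> r <= q -> (0 < m)%N -> bh_constant Y r q m = 0%E ->
  bh_vanishes Y r m.
Proof.
move=> h1r hrq m0 b0 X v T sv bT i.
have p0 : 0 < bh_exponent r q m by exact: bh_exponent_gt0.
have [c cge0 cE] := summing_norm_fin _ _ _ _ _ _ sv.
have [M M0 TM] := multilinear_norm_fin _ _ _ _ _ bT.
apply/eqP; rewrite eq_le nrm_ge0 andbT leNgt; apply/negP => n0.
set z := nrm _ in n0.
(* Adding 1 keeps the denominator positive when [c * M] is zero. *)
have cM : 0 < c * M + 1 by rewrite ltr_wpDl// mulr_ge0.
have : (bh_constant Y r q m < (z / (c * M + 1))%:E)%E.
  by rewrite b0 lte_fin divr_gt0.
move=> /best_constant_lt[C [C0 bhC]]; rewrite ltr_pdivlMr// => Cz.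
pose N := (\max_j i j).+1.
have iN j : (i j < N)%N by rewrite ltnS leq_bigmax.
have iE : i = ffun_nat [ffun j => Ordinal (iN j)].
  by apply/ffunP => j; rewrite !ffunE.
have := bh_bound_sum_le _ _ _ _ _ _ N _ h1r hrq m0 C0 bhC X v T c M sv bT
  cge0 cE M0.
rewrite TM => /(_ (lexx _)).
rewrite (bigD1 [ffun j => Ordinal (iN j)])//= -iE -/z => H.
have {}H : z `^ bh_exponent r q m <= (C * c * M) `^ bh_exponent r q m.
  by apply: le_trans H; rewrite lerDl sumr_ge0// => b _; exact: powR_ge0.
have CcM : 0 <= C * c * M by rewrite !mulr_ge0// ltW.
have : z <= C * c * M.
  by rewrite leNgt; apply: contraTN H => ?; rewrite -ltNge gt0_ltr_powR ?nnegrE// ltW.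
rewrite leNgt => /negP; apply; apply: le_lt_trans Cz.
by rewrite mulrDr mulr1 mulrA lerDl ltW.
Qed.

(** Test the inequality on the one-element family [y], whose Rademacher average is its norm. *)
Lemma cotype_constant_ge1 (R : realType) (s : scalars)
    (Y : normedModType (field_of R s)) (q : R) (y : Y) :
  0 < q -> nrm y != 0 -> (1%:E <= cotype_constant Y q)%E.
Proof.
move=> q0 yn; have y0 : 0 < nrm y by rewrite lt_neqAle eq_sym yn nrm_ge0.
apply: le_ereal_inf_tmp => _ [kappa [_ H] <-]; rewrite lee_fin.
have := H 1%N (fun=> y); rewrite rademacher_average1// -EFinM lee_fin.
rewrite big_ord1 powRK ?nrm_ge0 ?mulfV ?gt_eqF//.
by rewrite -[leLHS]mul1r ler_pM2r.
Qed.

Lemma kahane_constant_ge1 (R : realType) (s : scalars)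
    (Y : completeNormedModType (field_of R s)) (a b : R) (y : Y) :
  0 < a -> 0 < b -> nrm y != 0 -> (1%:E <= kahane_constant s a b)%E.
Proof.
move=> a0 b0 yn; have y0 : 0 < nrm y by rewrite lt_neqAle eq_sym yn nrm_ge0.
apply: le_ereal_inf_tmp => _ [K [_ H] <-]; rewrite lee_fin.
have := H Y 1%N (fun=> y); rewrite !rademacher_average1// -EFinM lee_fin.
by rewrite -[leLHS]mul1r ler_pM2r.
Qed.

(** * Iteration and passage to the infima *)

(** A Kahane constant for the exponent at level [k] also works at every later level, since the
    exponents, and with them the averages on the right, increase. *)
Lemma bh_bound_iter (R : realType) (s : scalars)
    (Y : normedModType (field_of R s)) (r q : R) (k n : nat) (kappa K C : R) :
  1 <= r -> r <= q -> (0 < k)%N -> 0 < kappa -> 0 < K -> 0 < C ->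
  cotype_ineq Y q kappa ->
  (forall n (x : 'I_n -> Y), (rademacher_average 2 x <=
    K%:E * rademacher_average (bh_exponent r q k) x)%E) ->
  bh_bound Y r q k C -> bh_bound Y r q (n + k) ((kappa * K) ^+ n * C).
Proof.
move=> h1r hrq k0 kappa0 K0 C0 cotY KY bhC.
elim: n => [|n IH]; first by rewrite expr0 mul1r.
rewrite exprS -mulrA; apply: bh_boundS => //.
- by rewrite addn_gt0 k0 orbT.
- by rewrite !mulr_gt0// exprn_gt0// mulr_gt0.
move=> l x; apply: (le_trans (KY l x)); apply: lee_wpmul2l.
  by rewrite lee_fin ltW.
apply: rademacher_average_le; first exact: bh_exponent_gt0.
by apply: bh_exponent_mono => //; exact: leq_addl.
Qed.

(** Continuity of the right-hand side: if [z] exceeded it, the three constants could all be enlarged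
    by a common factor [d > 1] so that it just reaches [z]. *)
Lemma le_of_approx (R : realType) (n : nat) (c k b z : R) :
  0 < c -> 0 < k -> 0 < b ->
  (forall c' k' b', c < c' -> k < k' -> b < b' ->
    exists x, z <= x /\ x < (c' * k') ^+ n * b') ->
  z <= (c * k) ^+ n * b.
Proof.
move=> c0 k0 b0 H; set W := _ * b; rewrite leNgt; apply/negP => Wz.
have W0 : 0 < W by rewrite mulr_gt0// exprn_gt0// mulr_gt0.
have zW : 1 < z / W by rewrite ltr_pdivlMr// mul1r.
(* The product has 2n + 1 factors, each scaled by [d]. *)
pose N := (n + n).+1; pose d := (z / W) `^ (N%:R^-1).
have N0 : 0 < N%:R^-1 :> R by rewrite invr_gt0 ltr0n.
have d1 : 1 < d.
  have e1 : 1 `^ N%:R^-1 = 1 :> R by rewrite powR1.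
  rewrite -[ltLHS]e1 /d gt0_ltr_powR ?nnegrE//.
  by rewrite (le_trans _ (ltW zW)).
have dN : d ^+ N = z / W.
  rewrite -powR_mulrn ?powR_ge0// powRK// ?mulVf ?pnatr_eq0//.
  by rewrite (le_trans _ (ltW zW)).
have lt_d a : 0 < a -> a < a * d by move=> a0; rewrite ltr_pMr.
have [x [zx]] := H _ _ _ (lt_d c c0) (lt_d k k0) (lt_d b b0).
have -> : (c * d * (k * d)) ^+ n * (b * d) = W * d ^+ N.
  by rewrite /W /N mulrACA !exprMn exprS exprD; ring.
rewrite dN mulrC divfK ?gt_eqF// => /(le_lt_trans zx).
by rewrite ltxx.
Qed.

Theorem theorem6p2 (R : realType) (s : scalars)
    (Y : completeNormedModType (field_of R s)) (r q : R)
    (h1r : 1 <= r) (hrq : r <= q) (hY : has_cotype Y q)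
    (m k : nat) (hm : (2 <= m)%N) (hk1 : (1 <= k)%N) (hkm : (k < m)%N) :
  (bh_constant Y r q m <=
    (cotype_constant Y q *
       kahane_constant s ((q * r * k%:R) / (q + (k%:R - 1) * r)) 2) ^+ (m - k)
    * bh_constant Y r q k)%E.
Proof.
rewrite -[_ / _]/(bh_exponent r q k); set p := bh_exponent r q k.
have p0 : 0 < p by exact: bh_exponent_gt0.
have q0 : 0 < q by lra.
have m0 : (0 < m)%N by exact: ltnW.
set n := (m - k)%N; have mE : m = (n + k)%N by rewrite subnK// ltnW.
have n0 : (0 < n)%N by rewrite subn_gt0.
have rhs0 : (0 <= (cotype_constant Y q * kahane_constant s p 2) ^+ n
    * bh_constant Y r q k)%E.
  by rewrite mule_ge0 ?expe_ge0 ?mule_ge0 ?best_constant_ge0.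
(* Settles the cases where a factor on the right could be 0, that is [Y = 0] or a zero constant at
   level [k]. *)
have van : bh_vanishes Y r m -> (bh_constant Y r q m <=
    (cotype_constant Y q * kahane_constant s p 2) ^+ n
    * bh_constant Y r q k)%E.
  by move=> vm; apply: le_trans rhs0; exact: bh_vanishes_constant.
have [Y0|/existsNP[y /eqP yn]] := pselect (forall y : Y, nrm y = 0).
  by apply: van => X v T _ _ i; exact: Y0.
have [b0|bn0] := eqVneq (bh_constant Y r q k) 0%E.
  by apply: van; rewrite mE; apply: bh_vanishes_add; exact: bh_constant0_vanishes b0.
have b0 : (0 < bh_constant Y r q k)%E.
  by rewrite lt_def bn0 best_constant_ge0.
(* With both constants at least 1, an infinite factor makes the right side [+oo]. *)
have := cotype_constant_ge1 _ _ _ _ _ q0 yn.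
have := kahane_constant_ge1 _ _ _ _ 2 _ p0 (ltr0Sn _ _) yn.
have [kappa1 [kappa10 cot1]] := hY.
have [c c0 cE] := best_constant_fin _ _ _ kappa10 cot1.
rewrite -[cotype_constant Y q]/(best_constant _) cE in van rhs0 *.
case KE : (kahane_constant s p 2) => [K||]//; last first.
  move=> _; rewrite lee_fin => c1; rewrite gt0_muley ?lte_fin ?(lt_le_trans _ c1)//.
  have -> : (+oo ^+ n = +oo :> \bar R)%E.
    rewrite -(prednK n0); elim: n.-1 => [|l IH]; first by [].
    by rewrite expeS IH mulyy.
  by rewrite gt0_mulye// leey.
rewrite !lee_fin => K1 c1; rewrite -EFinM -EFin_expe.
have cp : 0 < c by lra.
have Kp : 0 < K by lra.
have cK0 : 0 < (c * K) ^+ n by rewrite exprn_gt0// mulr_gt0.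
case bE : (bh_constant Y r q k) b0 => [b||]//; last first.
  by rewrite gt0_muley ?lte_fin// leey.
rewrite lte_fin => bp.
have approx c' K' b' : c < c' -> K < K' -> b < b' -> exists x,
    (bh_constant Y r q m <= x%:E)%E /\ x < (c' * K') ^+ n * b'.
  move=> cc' KK' bb'.
  have [kappa [kappa0 cotY kappac]] : exists C, [/\ 0 < C, cotype_ineq Y q C & C < c'].
    by apply: best_constant_lt; rewrite cE lte_fin.
  have /best_constant_lt[L [L0 kahL LK]] : (kahane_constant s p 2 < K'%:E)%E.
    by rewrite KE lte_fin.
  have /best_constant_lt[C [C0 bhC Cb]] : (bh_constant Y r q k < b'%:E)%E.
    by rewrite bE lte_fin.
  exists ((kappa * L) ^+ n * C); split.
    apply: best_constant_le; first by rewrite mulr_gt0// exprn_gt0// mulr_gt0.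
    suff : bh_bound Y r q m ((kappa * L) ^+ n * C) by [].
    rewrite [X in bh_bound _ _ _ X]mE.
    by apply: bh_bound_iter => //; exact: kahL.
  have le1 : (kappa * L) ^+ n <= (c' * K') ^+ n.
    by rewrite lerXn2r ?nnegrE ?ler_pM// ?mulr_ge0 ?ltW//; lra.
  rewrite (le_lt_trans (ler_wpM2r (ltW C0) le1))// ltr_pM2l//.
  by rewrite exprn_gt0// mulr_gt0; lra.
have lt1 a : a < a + 1 :> R by rewrite ltrDl.
(* A first use of [approx], with arbitrary enlargements, shows that the constant at level [m] is
   finite. *)
have [x1 [zx1 _]] := approx _ _ _ (lt1 c) (lt1 K) (lt1 b).
have z0 : (0 <= bh_constant Y r q m)%E by exact: best_constant_ge0.
case zE : (bh_constant Y r q m) z0 zx1 approx => [z||]// _ _ approx.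
rewrite -EFinM lee_fin; exact: le_of_approx.
Qed.
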